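(* For every positive integer $m$ and all $w_1,w_2\in y\mathcal{H}$, \[ \sum_{\substack{a,b\ge1\\ a+b=m}}Z^\diamondsuit(\phi(w_1)\circledast y^a)\,Z^\diamondsuit(\phi(w_2)\circledast y^b)=Z^\diamondsuit(\phi(w_1*w_2)\circledast y^m), \] where the product on the left is the termwise product of sequences in $\mathbb{Q}^{\mathbb{N}}$.
   Context: $[n]=\{1,\dots,n\}$. For $N\ge1$ and an admissible index (tuple of positive integers, nonempty, last entry $\ge2$) $\boldsymbol{k}=(k_1,\dots,k_r)$: $[r]^1_{\boldsymbol{k}}=\{i:k_i=1\}$, $S_{r,N}(A)=\{(n_1,\dots,n_r)\in[N-1]^r: n_i\le n_{i+1}\ (i\in A),\ n_i<n_{i+1}\ (i\in[r-1]\setminus A)\}$, $\zeta^\diamondsuit_N(\boldsymbol{k})=\sum_{A\subset[r]^1_{\boldsymbol{k}}}\sum_{S_{r,N}(A)}\prod_{i\in A}(N-n_i)^{-1}\prod_{i\notin A}n_i^{-k_i}$, $\zeta^\diamondsuit(\boldsymbol{k})=(\zeta^\diamondsuit_N(\boldsymbol{k}))_{N\ge1}$. $\mathcal{H}=\mathbb{Q}\langle x,y\rangle$, $\mathcal{H}^1=\mathbb{Q}+y\mathcal{H}$, $\mathcal{H}^0=\mathbb{Q}+y\mathcal{H}x$, $e_k=yx^{k-1}$; $Z^\diamondsuit\colon\mathcal{H}^0\to\mathbb{Q}^{\mathbb{N}}$ is $\mathbb{Q}$-linear, $Z^\diamondsuit(1)=(1)_N$, $Z^\diamondsuit(e_{k_1}\cdots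 e_{k_r})=\zeta^\diamondsuit(k_1,\dots,k_r)$. $\phi$ is the algebra automorphism of $\mathcal{H}$ with $\phi(x)=x+y$, $\phi(y)=-y$. Harmonic product $*$ on $\mathcal{H}^1$: $\mathbb{Q}$-bilinear, $w*1=1*w=w$, $w_1e_{k_1}*w_2e_{k_2}=(w_1*w_2e_{k_2})e_{k_1}+(w_1e_{k_1}*w_2)e_{k_2}+(w_1*w_2)e_{k_1+k_2}$ for words $w_1,w_2\in\mathcal{H}^1$. The $\mathbb{Q}$-bilinear product $\circledast$ on $y\mathcal{H}$ is $w_1e_{k_1}\circledast w_2e_{k_2}=(w_1*w_2)e_{k_1+k_2}$ for words $w_1,w_2\in\mathcal{H}^1$ and positive integers $k_1,k_2$. *)

(* Defs.v *)
From mathcomp Require Import all_boot all_order all_algebra.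
Set Implicit Arguments. Unset Strict Implicit. Unset Printing Implicit Defensive.
Import Order.TTheory GRing.Theory Num.Theory.
Local Open Scope ring_scope.

Definition word := seq bool.
Notation lx := false.
Notation ly := true.

(* An element of H = Q<x,y> is represented as a formal finite Q-linear
   combination of words (a list of (coefficient, word) pairs).  All the
   operations below are defined termwise (bi)linearly on this representation,
   so Z^diamond of any expression only depends on the polynomial represented. *)
Definition Hpoly := seq (rat * word).

Definition e (k : nat) : word := ly :: nseq k.-1 lx.

(* Words of y H (or the empty word) are exactly products e_{k1} ... e_{kr};
   [to_idx] returns the index (k1,...,kr), or None if the word starts with x. *)
Fixpoint to_idx_aux (cur : nat) (w : word) : seq nat :=
  match w with
  | [::] => [:: cur]
  | false :: w' => to_idx_aux cur.+1 w'
  | true :: w' => cur :: to_idx_aux 1 w'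
  end.

Definition to_idx (w : word) : option (seq nat) :=
  match w with
  | [::] => Some [::]
  | true :: w' => Some (to_idx_aux 1 w')
  | false :: _ => None
  end.

Definition of_idx (s : seq nat) : word := flatten (map e s).

(* Harmonic product on indices, following the recursion on the LAST letter
   e_k of the paper; we work with reversed index lists (last entry first),
   so that appending e_k at the end is [cons k].  The result is a list of
   indices (all with coefficient 1). *)
Fixpoint rharm (s : seq nat) : seq nat -> seq (seq nat) :=
  match s with
  | [::] => fun t => [:: t]
  | k1 :: u1 =>
    fix rharm2 (t : seq nat) : seq (seq nat) :=
      match t with
      | [::] => [:: s]
      | k2 :: u2 =>
          map (cons k1) (rharm u1 t) ++ map (cons k2) (rharm2 u2)
          ++ map (cons (k1 + k2)%N) (rharm u1 u2)
      end
  end.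

Definition harm_idx (s t : seq nat) : seq (seq nat) :=
  map rev (rharm (rev s) (rev t)).

(* w1 e_{k1} (.) w2 e_{k2} = (w1 * w2) e_{k1+k2}, on indices (forward order) *)
Definition cst_idx (s t : seq nat) : seq (seq nat) :=
  match rev s, rev t with
  | k1 :: r1, k2 :: r2 => map (fun u => rev ((k1 + k2)%N :: u)) (rharm r1 r2)
  | _, _ => [::]
  end.

Definition harm (p q : Hpoly) : Hpoly :=
  flatten [seq flatten [seq
     match to_idx a.2, to_idx b.2 with
     | Some s, Some t => [seq (a.1 * b.1, of_idx u) | u <- harm_idx s t]
     | _, _ => [::]
     end | b <- q] | a <- p].

Definition cst (p q : Hpoly) : Hpoly :=
  flatten [seq flatten [seq
     match to_idx a.2, to_idx b.2 with
     | Some s, Some t => [seq (a.1 * b.1, of_idx u) | u <- cst_idx s t]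
     | _, _ => [::]
     end | b <- q] | a <- p].

Definition pmul (p q : Hpoly) : Hpoly :=
  flatten [seq [seq (a.1 * b.1, a.2 ++ b.2) | b <- q] | a <- p].

Definition phi_letter (l : bool) : Hpoly :=
  if l then [:: (-1, [:: ly])] else [:: (1, [:: lx]); (1, [:: ly])].

Fixpoint phi_word (w : word) : Hpoly :=
  match w with
  | [::] => [:: (1, [::])]
  | l :: w' => pmul (phi_letter l) (phi_word w')
  end.

Definition phi (p : Hpoly) : Hpoly :=
  flatten [seq [seq (a.1 * b.1, b.2) | b <- phi_word a.2] | a <- p].

Definition ypow (a : nat) : Hpoly := [:: (1, nseq a ly)].

(* zeta^diamond_N(k_1,...,k_r): sum over A subset of {i : k_i = 1} and over
   (n_1,...,n_r) in [N-1]^r with n_i <= n_{i+1} (i in A), n_i < n_{i+1}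
   (i in [r-1] \ A); indices are shifted to 0,...,r-1. *)
Definition zeta_dia_N (N : nat) (k : seq nat) : rat :=
  let r := size k in
  \sum_(A : {set 'I_r} | [forall i in A, nth 0%N k i == 1%N])
   \sum_(n : {ffun 'I_r -> 'I_N} |
          [forall i, 0 < n i]%N &&
          [forall i : 'I_r, forall j : 'I_r, (nat_of_ord j == i.+1) ==>
              (if i \in A then (n i <= n j)%N else (n i < n j)%N)])
     (\prod_(i in A) ((N - n i)%:R)^-1 *
      \prod_(i : 'I_r | i \notin A) ((n i)%:R ^- nth 0%N k i)).

(* Z^diamond on a word of H^0 (words starting with x do not lie in H^0 and
   are sent to 0; they never occur in the statement). *)
Definition Zdia_word (w : word) (N : nat) : rat :=
  match to_idx w with
  | Some k => zeta_dia_N N k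
  | None => 0
  end.

Definition Zdia (p : Hpoly) (N : nat) : rat :=
  \sum_(a <- p) a.1 * Zdia_word a.2 N.

Definition in_yH (p : Hpoly) : bool := all (fun a => head lx a.2 == ly) p.

(* Main.v *)
Require Import Defs.
From mathcomp Require Import all_boot all_order all_algebra.
From mathcomp Require Import ring zify.
Set Implicit Arguments. Unset Strict Implicit. Unset Printing Implicit Defensive.
Import GRing.Theory Num.Theory.
Local Open Scope ring_scope.

(* Fix N and work over K = Q[t]/(t^(m+1)). The claim is that the generating series
   G(w) = sum_j t^j Z_N(phi(w) (.) y^j) is multiplicative for the harmonic product. Summing
   the chains of n_i from left to right, the letters y inserted by the harmonic product with
   1/(1 - t y) contribute an overall factor, so that G(w) = sum_n c(n) S_n(w) where the
   noncommutative series S_n = sum_w S_n(w) w satisfies, with A = X - Y and u = N - t,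
     S_n (n - X) (u - n - A) = (u - n) S_(n-1) (n - 1 - Y),   S_0 = 1.
   Keep u fixed and let the other occurrences of N vary: the sum becomes a Newton series W_M
   in M, and a noncommutative form of the Pfaff-Saalschuetz summation gives
     W_(M+1) (M - X) (u - M - A) = W_M (u - M - X) (M - A),   W_1 = 1.
   Hence W_N is a product of the factors (M - A) (M - X)^-1 = 1 + sum_k M^-k Y X^(k-1) and of
   inverses of such factors, all of which are group-like for the harmonic product. *)

(** * Right multiplication of noncommutative series *)

Section RightMultiplication.
Variable K : comNzRingType.
Implicit Types (F G : word -> K) (a b c : K) (w : word).

(* [F] stands for the series sum_w F(w) w, words being read from their last letter, and
   [mulX F], [mulY F], [subX a F], [subY a F], [subA a F] for the products of this series on
   the right by X, Y, a - X, a - Y and a - A, where A = X - Y. *)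
Definition mulX F w : K := if w is false :: w' then F w' else 0.
Definition mulY F w : K := if w is true :: w' then F w' else 0.
Definition subX a F w : K := a * F w - mulX F w.
Definition subY a F w : K := a * F w - mulY F w.
Definition subA a F w : K := a * F w - mulX F w + mulY F w.

Lemma mulX_ext F G : F =1 G -> mulX F =1 mulX G.
Proof. by move=> FG [|[] w] /=. Qed.

Lemma mulY_ext F G : F =1 G -> mulY F =1 mulY G.
Proof. by move=> FG [|[] w] /=. Qed.

Lemma subX_ext a F G : F =1 G -> subX a F =1 subX a G.
Proof. by move=> FG w; rewrite /subX FG (mulX_ext FG). Qed.

Lemma subA_ext a F G : F =1 G -> subA a F =1 subA a G.
Proof. by move=> FG w; rewrite /subA FG (mulX_ext FG) (mulY_ext FG). Qed.

Lemma subA_comm a b F : subA a (subA b F) =1 subA b (subA a F).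
Proof.
by move=> [|[] [|[] w]]; rewrite /subA /=; ring.
Qed.

Lemma subA_inj a a' F G : a' * a = 1 -> subA a F =1 subA a G -> F =1 G.
Proof.
move=> aK FG; elim=> [|l w IH].
  have := FG [::]; rewrite /subA /= => /(congr1 ( *%R a')).
  by rewrite !subr0 !addr0 !mulrA aK !mul1r.
have /(congr1 ( *%R a')) := FG (l :: w); rewrite /subA.
by case: l => /=; rewrite IH !mulrDr => /addIr/addIr; rewrite !mulrA aK !mul1r.
Qed.

(** Since A = X - Y, (a - X)(b - A) = ab - (a + b)X + aY + XA. With a + b fixed, only the constant
    and the coefficient of Y change, and ab - cd = -(a - c)(a - d). *)
Lemma subXA_shift (a b : K) (c d : K) F : a + b = c + d ->
  subA b (subX a F) =1
  fun w => subA d (subX c F) w + (a - c) * ((a - d) * - F w + mulY F w).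
Proof.
move=> abE.
have -> : b = c + d - a by rewrite -abE; ring.
by move=> [|[] [|[] w]]; rewrite /subA /subX /=; ring.
Qed.

Lemma subXA_subY a b F :
  (fun w => subA b (subX a F) w + (b - a) * mulY F w) =1 subA a (subX b F).
Proof.
by move=> [|[] [|[] w]]; rewrite /subA /subX /=; ring.
Qed.

(* Division by [a - A] on the right, when [a] has the inverse [a']. *)
Fixpoint divA (a' : K) F w : K :=
  match w with
  | [::] => a' * F [::]
  | l :: w' => a' * (F w + (if l then - divA a' F w' else divA a' F w'))
  end.

Lemma divAK a a' F : a' * a = 1 -> subA a (divA a' F) =1 F.
Proof.
move=> aK; case=> [|[] w]; rewrite /subA /=;
  rewrite mulrA [a * a']mulrC aK mul1r; ring.
Qed.

End RightMultiplication.

(** * Harmonic product *)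

Section QuasiShuffle.
Variable K : comNzRingType.

(** Indices have their last entry first, as in [rharm]. Such an [F] is a series that is group-like
    for the coproduct dual to the harmonic product. *)
Definition is_harm_hom (F : seq nat -> K) :=
  F [::] = 1 /\ forall s t, all (leq 1) s -> all (leq 1) t ->
    \sum_(u <- rharm s t) F u = F s * F t.

Lemma is_harm_hom_ext F G : F =1 G -> is_harm_hom F -> is_harm_hom G.
Proof.
move=> FG [F1 FM]; split=> [|s t ps pt]; first by rewrite -FG.
by rewrite -!FG -FM //; apply: eq_bigr => l _; rewrite FG.
Qed.

Lemma rharm_nil s : rharm s [::] = [:: s].
Proof. by case: s. Qed.

Lemma rharm_cons k1 u1 k2 u2 : rharm (k1 :: u1) (k2 :: u2) =
  map (cons k1) (rharm u1 (k2 :: u2)) ++ map (cons k2) (rharm (k1 :: u1) u2)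
  ++ map (cons (k1 + k2)%N) (rharm u1 u2).
Proof. by []. Qed.

Variables (F G : seq nat -> K) (f : K).
Hypotheses (FG0 : F [::] = G [::])
  (FG : forall k s, (0 < k)%N -> F (k :: s) = G (k :: s) + f ^+ k * G s).

Lemma sum_rharm_cons k1 u1 k2 u2 (H : seq nat -> K) :
  \sum_(u <- rharm (k1 :: u1) (k2 :: u2)) H u =
  \sum_(u <- rharm u1 (k2 :: u2)) H (k1 :: u) +
  \sum_(u <- rharm (k1 :: u1) u2) H (k2 :: u) +
  \sum_(u <- rharm u1 u2) H ((k1 + k2)%N :: u).
Proof. by rewrite rharm_cons !big_cat !big_map /= addrA. Qed.

Lemma sum_rharm_consE k1 u1 k2 u2 : (0 < k1)%N -> (0 < k2)%N ->
  \sum_(u <- rharm (k1 :: u1) (k2 :: u2)) F u =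
  \sum_(u <- rharm (k1 :: u1) (k2 :: u2)) G u +
  f ^+ k1 * \sum_(u <- rharm u1 (k2 :: u2)) G u +
  f ^+ k2 * \sum_(u <- rharm (k1 :: u1) u2) G u +
  f ^+ (k1 + k2) * \sum_(u <- rharm u1 u2) G u.
Proof.
move=> k1_gt0 k2_gt0.
have step k l : (0 < k)%N -> \sum_(u <- l) F (k :: u) =
    \sum_(u <- l) G (k :: u) + f ^+ k * \sum_(u <- l) G u.
  by move=> k_gt0; rewrite mulr_sumr -big_split; apply: eq_bigr => u _; rewrite FG.
by rewrite !sum_rharm_cons !step ?addn_gt0 ?k1_gt0 //; ring.
Qed.

(** [F] is the series [G] times 1 + sum_k f^k e_k. This factor is group-like: the merged entry k1 +
    k2 has the weight f^k1 f^k2 that the product of two factors requires. *)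
Lemma is_harm_hom_mul : is_harm_hom G -> is_harm_hom F.
Proof.
move=> [G1 GM]; split=> [|[|k1 u1] [|k2 u2] ps pt]; first by rewrite FG0.
- by rewrite big_seq1 FG0 G1 mulr1.
- by rewrite big_seq1 FG0 G1 mul1r.
- by rewrite rharm_nil big_seq1 FG0 G1 mulr1.
move: (ps) (pt) => /= /andP[k1_gt0 pu1] /andP[k2_gt0 pu2].
by rewrite sum_rharm_consE ?GM ?FG // exprD; ring.
Qed.

(** By induction on the total length: [sum_rharm_consE] can be solved for the sum of [G], as its
    other sums of [G] involve shorter indices. *)
Lemma is_harm_hom_div : is_harm_hom F -> is_harm_hom G.
Proof.
move=> [F1 FM]; split=> [|s t ps pt]; first by rewrite -FG0.
have [n] := ubnP (size s + size t)%N; elim: n s t ps pt => // n IH [|k1 u1] [|k2 u2] ps pt.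
- by rewrite big_seq1 -FG0 F1 mulr1.
- by rewrite big_seq1 -FG0 F1 mul1r.
- by rewrite rharm_nil big_seq1 -FG0 F1 mulr1.
move: (ps) (pt) => /= /andP[k1_gt0 pu1] /andP[k2_gt0 pu2] szn.
have := sum_rharm_consE u1 u2 k1_gt0 k2_gt0; rewrite FM ?FG //.
rewrite (IH u1 (k2 :: u2)) ?(IH (k1 :: u1) u2) ?(IH u1 u2) //=; [|lia..].
set T := \sum_(u <- _) _ => E.
have -> : T = (T + f ^+ k1 * (G u1 * G (k2 :: u2)) +
      f ^+ k2 * (G (k1 :: u1) * G u2) + f ^+ (k1 + k2) * (G u1 * G u2))
     - f ^+ k1 * (G u1 * G (k2 :: u2)) -
      f ^+ k2 * (G (k1 :: u1) * G u2) - f ^+ (k1 + k2) * (G u1 * G u2) by ring.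
by rewrite -E exprD; ring.
Qed.

End QuasiShuffle.

(* The reversed word of the index whose entries, last one first, are [s]. *)
Fixpoint rword (s : seq nat) : word :=
  if s is k :: s' then nseq k.-1 false ++ true :: rword s' else [::].

(** Here F = G (a - A)(a - X)^-1, and (a - A)(a - X)^-1 = 1 + Y (a - X)^-1 = 1 + sum_k a^-k Y
    X^(k-1). *)
Lemma subX_subA_rword (K : comNzRingType) (a a' : K) (F G : word -> K) :
  a' * a = 1 -> subX a F =1 subA a G ->
  F [::] = G [::] /\
  forall k s, F (rword (k.+1 :: s)) = G (rword (k.+1 :: s)) + a' ^+ k.+1 * G (rword s).
Proof.
move=> aK FG.
have cancel b c : a * b = c -> b = a' * c by move=> <-; rewrite mulrA aK mul1r.
split=> [|k s].
  have := FG [::]; rewrite /subX /subA /= addr0 !subr0.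
  by move/cancel; rewrite mulrA aK mul1r.
elim: k => [|k IH].
  have := FG (true :: rword s); rewrite /subX /subA /= !subr0 => /cancel ->.
  by rewrite mulrDr mulrA aK mul1r expr1.
have := FG (false :: rword (k.+1 :: s)); rewrite /subX /subA -[mulX F _]/(F _).
rewrite -[mulX G _]/(G _) IH -[rword (k.+2 :: s)]/(false :: rword (k.+1 :: s)).
rewrite [mulY _ _]/= addr0 => /eqP; rewrite subr_eq => /eqP/cancel ->.
by rewrite addrA subrK mulrDr mulrA aK mul1r [a' ^+ k.+2]exprS !mulrA.
Qed.

(** * The noncommutative summation formula *)

Section NewtonSeries.
Variables (K : comNzRingType) (iv : nat -> K) (u : K).
Hypothesis ivK : forall n, n.+1%:R * iv n.+1 = 1.

(** With L(x) = x(x - u - 1), this is the Newton basis polynomial prod_(1 <= i <= n) (L(x) - L(i))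
    divided by n!. *)
Fixpoint newton_coef (x : K) n : K :=
  if n is n'.+1 then newton_coef x n' * (x - u + n'%:R) * (x - n%:R) * iv n else 1.

(** The analogue with x(x - u) in place of L(x); it occurs in the difference of [newton_coef] in
    x. *)
Fixpoint newton_diff (x : K) n : K :=
  if n is n'.+1 then newton_diff x n' * (x - u + n%:R) * (x - n%:R) * iv n else 1.

Lemma newton_coef_diff x n :
  newton_coef x n * (x - u + n%:R) = (x - u) * newton_diff x n.
Proof.
elim: n => [|n IH] /=; first by rewrite addr0 mul1r mulr1.
by rewrite IH; ring.
Qed.

Lemma newton_coef_diffS x n :
  newton_coef (x + 1) n * (x - n%:R) = newton_diff x n * x.
Proof.
elim: n => [|n IH] /=; first by rewrite subr0.
have -> : x + 1 - n.+1%:R = x - n%:R by rewrite -[n.+1]addn1 natrD; ring.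
have -> : x + 1 - u + n%:R = x - u + n.+1%:R by rewrite -[n.+1]addn1 natrD; ring.
by transitivity (newton_coef (x + 1) n * (x - n%:R) * (x - u + n.+1%:R) *
  (x - n.+1%:R) * iv n.+1); [ring | rewrite IH; ring].
Qed.

(** Both terms are multiples of [newton_diff x n]; the cofactors differ by (n + 1)(2x - u), and n +
    1 cancels. *)
Lemma newton_coefB x n :
  newton_coef (x + 1) n.+1 - newton_coef x n.+1 = (x + x - u) * newton_diff x n.
Proof.
have := newton_coef_diff x n; have := newton_coef_diffS x n => /= E1 E2.
rewrite E2.
have -> : x + 1 - n.+1%:R = x - n%:R by rewrite -[n.+1]addn1 natrD; ring.
have -> : newton_coef (x + 1) n * (x + 1 - u + n%:R) * (x - n%:R) =
  newton_diff x n * x * (x + 1 - u + n%:R) by rewrite -E1; ring.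
transitivity ((x + x - u) * newton_diff x n * (n.+1%:R * iv n.+1));
  last by rewrite ivK mulr1.
by rewrite -[n.+1]addn1 natrD; ring.
Qed.

Lemma newton_diff_eq0 M n : (0 < M <= n)%N -> newton_diff M%:R n = 0.
Proof.
move=> /andP[M0]; elim: n => [|n IH] Mn; first by lia.
move: Mn; rewrite leq_eqVlt => /predU1P[->|/IH] /=; first by rewrite subrr mulr0 mul0r.
by move=> ->; rewrite !mul0r.
Qed.

Variables (N : nat) (a : nat -> word -> K).
Hypothesis a_rec : forall n, (n.+1 < N)%N ->
  subA (u - n.+1%:R) (subX n.+1%:R (a n.+1)) =1 subY n%:R (a n).

Definition newton_sum (x : K) (w : word) : K := \sum_(0 <= n < N) newton_coef x n * a n w.

Lemma mulX_sum (c : nat -> K) m1 m2 (F : nat -> word -> K) w :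
  mulX (fun w => \sum_(m1 <= n < m2) c n * F n w) w = \sum_(m1 <= n < m2) c n * mulX (F n) w.
Proof. by case: w => [|[] w] //=; rewrite big1 // => n _; rewrite mulr0. Qed.

Lemma mulY_sum (c : nat -> K) m1 m2 (F : nat -> word -> K) w :
  mulY (fun w => \sum_(m1 <= n < m2) c n * F n w) w = \sum_(m1 <= n < m2) c n * mulY (F n) w.
Proof. by case: w => [|[] w] //=; rewrite big1 // => n _; rewrite mulr0. Qed.

Lemma subX_sum b (c : nat -> K) m1 m2 (F : nat -> word -> K) w :
  subX b (fun w => \sum_(m1 <= n < m2) c n * F n w) w = \sum_(m1 <= n < m2) c n * subX b (F n) w.
Proof.
rewrite /subX mulX_sum mulr_sumr -sumrB; apply: eq_bigr => n _; ring.
Qed.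

Lemma subA_sum b (c : nat -> K) m1 m2 (F : nat -> word -> K) w :
  subA b (fun w => \sum_(m1 <= n < m2) c n * F n w) w = \sum_(m1 <= n < m2) c n * subA b (F n) w.
Proof.
rewrite /subA mulX_sum mulY_sum mulr_sumr -sumrB -big_split; apply: eq_bigr => n _ /=; ring.
Qed.

Lemma newton_sumB x w : (0 < N)%N ->
  newton_sum (x + 1) w - newton_sum x w =
  (x + x - u) * \sum_(0 <= n < N.-1) newton_diff x n * a n.+1 w.
Proof.
rewrite /newton_sum; case: N => // N' _ /=; rewrite -sumrB big_nat_recl //= subrr add0r.
rewrite mulr_sumr; apply: eq_bigr => n _.
by rewrite -mulrBl -/(newton_coef (x + 1) n.+1) -/(newton_coef x n.+1) newton_coefB mulrA.
Qed.

(** [subXA_shift] replaces (M - X)(u - M - A) by the factors of [a_rec]; the correction for n + 1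
    then combines with the term of index n + 1, and the sum telescopes. *)
Lemma newton_diff_sum M w : (0 < M < N)%N ->
  subA (u - M%:R) (subX M%:R
    (fun w => \sum_(0 <= n < N.-1) newton_diff M%:R n * a n.+1 w)) w =
  - mulY (newton_sum M%:R) w.
Proof.
move=> /andP[M0 MN].
rewrite (subA_ext _ (subX_sum _ _ _ _ _)) subA_sum /newton_sum mulY_sum.
pose x : K := M%:R.
(* [h n] is the correction from [subXA_shift] for [a n], set to 0 at n = 0, where no term produces
   it. *)
pose h n : K := if n is n'.+1 then newton_diff x n' * ((x - n%:R) *
   ((u - x - n%:R) * a n w + mulY (a n) w)) else 0.
have hE n : (n <= N.-1)%N -> newton_diff x n * subY n%:R (a n) w + h n =
    - (newton_coef x n * mulY (a n) w).
  case: n => [|n] nN; first by rewrite /h /subY /=; ring.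
  have := newton_coef_diff x n; rewrite /h /subY /= => E.
  rewrite E.
  transitivity (newton_diff x n * (x - n.+1%:R) * ((n.+1%:R * iv n.+1) *
     ((x - u + n.+1%:R) * a n.+1 w)
     - (x - u + n.+1%:R) * iv n.+1 * mulY (a n.+1) w
     + ((u - x - n.+1%:R) * a n.+1 w + mulY (a n.+1) w))); first by ring.
  rewrite ivK.
  transitivity (newton_diff x n * (x - n.+1%:R) *
    (((n.+1%:R * iv n.+1) - (x - u + n.+1%:R) * iv n.+1) * mulY (a n.+1) w)); first by rewrite ivK; ring.
  by ring.
have -> : \sum_(0 <= n < N.-1) newton_diff x n * subA (u - x) (subX x (a n.+1)) w =
    \sum_(0 <= n < N.-1) (newton_diff x n * subY n%:R (a n) w + h n.+1).
  rewrite !big_nat; apply: eq_bigr => n /andP[_ nN]; rewrite /h -mulrDr; congr (_ * _).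
  have E : x + (u - x) = n.+1%:R + (u - n.+1%:R) by ring.
  rewrite (subXA_shift (a n.+1) E) a_rec; last by lia.
  ring.
have h0 : h 0%N = 0 by [].
(* The boundary term has the right form because [newton_diff M%:R N.-1] vanishes: M is one of the
   nodes 1, ..., N - 1. *)
have hN : h N.-1 = - (newton_coef x N.-1 * mulY (a N.-1) w).
  by rewrite -hE // newton_diff_eq0 ?mul0r ?add0r //; lia.
rewrite -[in RHS](prednK (leq_ltn_trans (leq0n _) MN)) big_nat_recr //= opprD -hN.
rewrite -sumrN big_split /=.
have -> : \sum_(0 <= i < N.-1) h i.+1 = \sum_(0 <= i < N.-1) h i + h N.-1.
  by rewrite -[LHS]add0r -[in LHS]h0 -big_nat_recl // big_nat_recr.
rewrite addrA -big_split /=; congr (_ + _); rewrite !big_nat; apply: eq_bigr => n /andP[_ nN].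
by rewrite hE //; lia.
Qed.

(** Substituting W_(M+1) = W_M + (2M - u) D and D (M - X)(u - M - A) = - W_M Y leaves W_M times (M -
    X)(u - M - A) + (u - 2M) Y, which factors by [subXA_subY]. *)
Lemma newton_sumS M : (0 < M < N)%N ->
  subA (u - M%:R) (subX M%:R (newton_sum M.+1%:R)) =1
  subA M%:R (subX (u - M%:R) (newton_sum M%:R)).
Proof.
move=> MN w; rewrite -(subXA_subY M%:R (u - M%:R)).
pose D w := \sum_(0 <= n < N.-1) newton_diff M%:R n * a n.+1 w.
have WE : newton_sum M.+1%:R =1 fun w => newton_sum M%:R w + (M%:R + M%:R - u) * D w.
  move=> w'; rewrite /D -newton_sumB; last by lia.
  by rewrite addrC subrK -natr1.
rewrite (subA_ext _ (subX_ext _ WE)).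
have -> : mulY (newton_sum M%:R) w = - subA (u - M%:R) (subX M%:R D) w.
  by rewrite /D newton_diff_sum ?opprK.
by case: w => [|[] [|[] w]]; rewrite /subA /subX /=; ring.
Qed.

Variable vi : nat -> K.
Hypothesis viK : forall M, (0 < M < N)%N -> vi M * (u - M%:R) = 1.
Hypothesis a0 : forall w, a 0 w = (w == [::])%:R.

Lemma newton_sum1 w : (0 < N)%N -> newton_sum 1%:R w = (w == [::])%:R.
Proof.
rewrite /newton_sum; case: N => // N' _; rewrite big_nat_recl // a0 mul1r big1 ?addr0 // => n _.
suff -> : newton_coef 1%:R n.+1 = 0 by rewrite mul0r.
elim: n => [|n IH]; first by rewrite /= subrr mulr0 mul0r.
by rewrite -[LHS]/(newton_coef 1%:R n.+1 * _ * _ * _) IH !mul0r.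
Qed.

Lemma rword_eq0 k s : (rword (k :: s) == [::]) = false.
Proof. by rewrite /=; case: (k.-1). Qed.

Lemma newton_sum_harm_hom M : (0 < M <= N)%N ->
  is_harm_hom (fun s => newton_sum M%:R (rword s)).
Proof.
elim: M => // -[_ /= MN|M IH MN].
  split=> [|s t ps pt]; first by rewrite newton_sum1.
  case: s t ps pt => [|k1 u1] [|k2 u2] ps pt.
  - by rewrite big_seq1 newton_sum1 // mulr1.
  - by rewrite big_seq1 !newton_sum1 // mul1r.
  - by rewrite rharm_nil big_seq1 !newton_sum1 // mulr1.
  rewrite sum_rharm_cons !newton_sum1 // !rword_eq0 mul0r.
  by rewrite !big1 ?addr0 // => l _; rewrite newton_sum1 ?rword_eq0.
have {}MN : (0 < M.+1 < N)%N by lia.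
(* An intermediate series splits the recursion into one division and one multiplication by
   group-like factors; the common factor u - (M + 1) - A is cancelled by [subA_inj]. *)
pose W w := divA (vi M.+1) (subX (u - M.+1%:R) (newton_sum M.+1%:R)) w.
have WE : subA (u - M.+1%:R) W =1 subX (u - M.+1%:R) (newton_sum M.+1%:R).
  by apply: divAK; apply: viK.
have NE : subX M.+1%:R (newton_sum M.+2%:R) =1 subA M.+1%:R W.
  apply: (subA_inj (viK MN)) => w.
  by rewrite newton_sumS // -(subA_ext _ WE) subA_comm.
have [N0 NS] := subX_subA_rword (etrans (mulrC _ _) (ivK M)) NE.
have [W0 WS] := subX_subA_rword (viK MN) (fsym WE).
apply: (@is_harm_hom_mul _ _ (fun s => W (rword s)) (iv M.+1)) => // [[|k] s|] //.
apply: (@is_harm_hom_div _ (fun s => newton_sum M.+1%:R (rword s)) _ (vi M.+1)) => // [[|k] s|] //.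
by apply: IH; lia.
Qed.

End NewtonSeries.

(** * Words and the substitution phi *)

Section WordStates.
Variables (K : comNzRingType) (iota : {rmorphism rat -> K}) (N : nat) (t : K).
Variable v : nat -> K.
Hypothesis vK : forall n, (0 < n < N)%N -> v n * (N%:R - t - n%:R) = 1.

Definition ninv n : K := iota n%:R^-1.

Lemma ninv0 : ninv 0 = 0.
Proof. by rewrite /ninv invr0 rmorph0. Qed.

Lemma ninvK n : n.+1%:R * ninv n.+1 = 1.
Proof.
rewrite /ninv -(rmorph_nat iota) -rmorphM divff ?rmorph1 //.
by rewrite pnatr_eq0.
Qed.

(** Sums over the preceding value: strictly below n if it is outside of A, at most n if it is in
    A. *)
Definition waccum (sr : (nat -> K) * (nat -> K)) n : K :=
  \sum_(0 <= j < n) sr.1 j + \sum_(1 <= j < n.+1) sr.2 j * v j.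

(* For a word ending in e_k, the weights of the chains whose last entry is [n], summed over
   the letters y inserted below and divided by [connector n]: the first component is for n
   outside of A; the second one, zero unless k = 1, is for n in A and lacks the factor of n,
   which the insertions turn from 1/(N-n) into [v n] = 1/(N-n-t). *)
Fixpoint wstate (w : word) : (nat -> K) * (nat -> K) :=
  match w with
  | [::] => (fun n => (n == 0)%:R, fun=> 0)
  | true :: w' => (fun n => waccum (wstate w') n * ninv n, waccum (wstate w'))
  | false :: w' => (fun n => (wstate w').1 n * ninv n, fun=> 0)
  end.

Definition wsigma w := (wstate w).1.
Definition wchi w := waccum (wstate w).

Lemma wsigma0 w : wsigma w 0 = (w == [::])%:R.
Proof. by case: w => [|[] w]; rewrite /wsigma /= ?ninv0 ?mulr0. Qed.

Lemma wchi_nil n : (0 < n)%N -> wchi [::] n = 1.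
Proof.
case: n => // n _; rewrite /wchi /waccum /= big_nat_recl // big1 // big1 ?addr0 // => i _.
by rewrite mul0r.
Qed.

Lemma wsigma_rword k s n : (0 < k)%N ->
  wsigma (rword (k :: s)) n = wchi (rword s) n * ninv n ^+ k.
Proof.
case: k => // k _; rewrite /wsigma /=; elim: k => [|k IH] /=; first by rewrite expr1.
by rewrite IH -mulrA -exprSr.
Qed.

Lemma wchiS w n : wchi w n.+1 = wchi w n + wsigma w n + (wstate w).2 n.+1 * v n.+1.
Proof.
rewrite /wchi /waccum /wsigma big_nat_recr // [in X in _ + X = _]big_nat_recr //=.
by rewrite addrACA addrA.
Qed.

Lemma wchi_rwordS k s n : (0 < k)%N -> wchi (rword (k :: s)) n.+1 =
  wchi (rword (k :: s)) n + wchi (rword s) n * ninv n ^+ k +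
  (if k == 1%N then wchi (rword s) n.+1 * v n.+1 else 0).
Proof.
move=> k_gt0; rewrite wchiS wsigma_rword //; congr (_ + _).
by case: k k_gt0 => [|[|k]] // _; rewrite mul0r.
Qed.

Lemma wchi0 w : wchi w 0 = 0.
Proof. by rewrite /wchi /waccum !big_geq ?addr0. Qed.

Definition phi_lift (L : word -> K) (w : word) : K :=
  \sum_(a <- phi_word w) iota a.1 * L a.2.

Lemma eq_phi_lift L1 L2 w : L1 =1 L2 -> phi_lift L1 w = phi_lift L2 w.
Proof. by move=> E; apply: eq_bigr => a _; rewrite E. Qed.

Lemma phi_lift_nil L : phi_lift L [::] = L [::].
Proof. by rewrite /phi_lift big_seq1 rmorph1 mul1r. Qed.

Lemma sum_pmul (p q : Hpoly) (L : word -> K) :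
  \sum_(a <- pmul p q) iota a.1 * L a.2 =
  \sum_(a <- p) iota a.1 * \sum_(b <- q) iota b.1 * L (a.2 ++ b.2).
Proof.
rewrite /pmul big_flatten big_map; apply: eq_bigr => a _.
rewrite big_map mulr_sumr; apply: eq_bigr => b _ /=.
by rewrite rmorphM mulrA.
Qed.

Lemma phi_lift_cons L l w : phi_lift L (l :: w) =
  if l then - phi_lift (fun a => L (ly :: a)) w
  else phi_lift (fun a => L (lx :: a)) w + phi_lift (fun a => L (ly :: a)) w.
Proof.
rewrite {1}/phi_lift /= sum_pmul; case: l.
  by rewrite big_seq1 rmorphN1 mulN1r.
by rewrite big_cons big_seq1 rmorph1 !mul1r.
Qed.

Lemma phi_liftD L1 L2 w : phi_lift (fun a => L1 a + L2 a) w = phi_lift L1 w + phi_lift L2 w.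
Proof. by rewrite -big_split; apply: eq_bigr => a _; rewrite mulrDr. Qed.

Lemma phi_liftM L c w : phi_lift (fun a => L a * c) w = phi_lift L w * c.
Proof. by rewrite mulr_suml; apply: eq_bigr => a _; rewrite mulrA. Qed.

Lemma phi_lift_sum (r : seq nat) (L : nat -> word -> K) w :
  phi_lift (fun a => \sum_(j <- r) L j a) w = \sum_(j <- r) phi_lift (L j) w.
Proof.
by rewrite /phi_lift exchange_big; apply: eq_bigr => a _; rewrite mulr_sumr.
Qed.

Lemma phi_lift_rcons L w l : phi_lift L (rcons w l) =
  if l then - phi_lift (fun a => L (rcons a ly)) w
  else phi_lift (fun a => L (rcons a lx)) w + phi_lift (fun a => L (rcons a ly)) w.
Proof.
elim: w L => [|l' w IH] L; first by rewrite phi_lift_cons !phi_lift_nil.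
rewrite rcons_cons !phi_lift_cons !IH {IH}; case: l'; case: l; rewrite ?opprD ?opprK //.
by rewrite addrACA.
Qed.

(** The version for words read from the last letter, as in [wstate]. *)
Definition phi_rlift (L : word -> K) w := phi_lift (fun a => L (rev a)) (rev w).

Lemma phi_rlift_cons L l w : phi_rlift L (l :: w) =
  if l then - phi_rlift (fun a => L (ly :: a)) w
  else phi_rlift (fun a => L (lx :: a)) w + phi_rlift (fun a => L (ly :: a)) w.
Proof.
rewrite /phi_rlift rev_cons phi_lift_rcons.
have E b : phi_lift (fun a => L (rev (rcons a b))) (rev w) =
    phi_lift (fun a => L (b :: rev a)) (rev w) by apply: eq_phi_lift => a; rewrite rev_rcons.
by rewrite !E.
Qed.

Definition phisig n w := phi_rlift (fun a => wsigma a n) w.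
Definition phirho n w := phi_rlift (fun a => (wstate a).2 n) w.
Definition phichi n w := phi_rlift (fun a => wchi a n) w.

Lemma phichiE n w : phichi n w =
  \sum_(0 <= j < n) phisig j w + \sum_(1 <= j < n.+1) phirho j w * v j.
Proof.
rewrite /phichi /phi_rlift /wchi /waccum phi_liftD !phi_lift_sum; congr (_ + _).
by apply: eq_bigr => j _; rewrite phi_liftM.
Qed.

Lemma phisig0 w : phisig 0 w = (w == [::])%:R.
Proof.
rewrite /phisig; case: w => [|[] w].
- by rewrite /phi_rlift phi_lift_nil wsigma0.
- rewrite phi_rlift_cons /phi_rlift /phi_lift big1 ?oppr0 // => a _; by rewrite wsigma0 mulr0.
- by rewrite phi_rlift_cons /phi_rlift /phi_lift !big1 ?addr0 // => a _; rewrite wsigma0 mulr0.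
Qed.

Lemma phisig_nil n : (0 < n)%N -> phisig n [::] = 0.
Proof. by case: n => // n _; rewrite /phisig /phi_rlift phi_lift_nil. Qed.

Lemma phirho_nil n : phirho n [::] = 0.
Proof. by rewrite /phirho /phi_rlift phi_lift_nil. Qed.

(** Only words with last letter y have a second component, and y has coefficient 1 in phi(x) and -1
    in phi(y). *)
Lemma phirho_cons n l w : phirho n (l :: w) = if l then - phichi n w else phichi n w.
Proof.
rewrite /phirho phi_rlift_cons; case: l => //=.
by rewrite [X in X + _]big1 ?add0r // => a _; rewrite mulr0.
Qed.

Lemma phisig_cons n l w : n.+1%:R * phisig n.+1 (l :: w) =
  (if l then 0 else phisig n.+1 w) + phirho n.+1 (l :: w).
Proof.
rewrite phirho_cons /phisig phi_rlift_cons /wsigma /=.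
have E L : n.+1%:R * phi_rlift (fun a => L a * ninv n.+1) w = phi_rlift L w.
  by rewrite /phi_rlift phi_liftM mulrCA ninvK mulr1.
by case: l => /=; rewrite ?mulrN ?mulrDr !E ?add0r.
Qed.

(** The excluded word x fails at n = 0, where [phisig 0 [::]] is 1. *)
Lemma phisig_consE n l w : l || (w != [::]) ->
  n%:R * phisig n (l :: w) = (if l then 0 else phisig n w) + phirho n (l :: w).
Proof.
case: n => [|n] lw; last exact: phisig_cons.
rewrite mul0r phirho_cons phichiE !big_geq // phisig0.
by case: l lw => /=; rewrite !(addr0, add0r, oppr0) // => /negPf ->.
Qed.

Lemma phichiS n w :
  phichi n.+1 w = phichi n w + phisig n w + phirho n.+1 w * v n.+1.
Proof. rewrite !phichiE big_nat_recr // [in X in _ + X = _]big_nat_recr //=.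
by rewrite addrACA addrA. Qed.

Lemma phirho_rec n l w : (n.+1 < N)%N -> l || (w != [::]) ->
  (N%:R - t - n.+1%:R) * phirho n.+1 (l :: w) +
    (if l then phirho n.+1 w else - phirho n.+1 w) =
  (N%:R - t - n.+1%:R) * (n%:R * phisig n (l :: w) - if l then phisig n w else 0).
Proof.
move=> nN lw; have := @vK n.+1 nN; set u := N%:R - t - _ => uK.
rewrite phisig_consE // !phirho_cons phichiS.
have E x : u * (x * v n.+1) = x by rewrite mulrCA -[in RHS](mulr1 x) -uK [u * _]mulrC.
by case: l {lw}; rewrite ?mulrN !mulrDr E; ring.
Qed.

(* [phisigY_rec] fails for [phisig] on words starting with x, which do not matter. *)
Definition phisigY n w := if last ly w then phisig n w else 0.

Lemma phisigY_rec n : (n.+1 < N)%N ->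
  subA (N%:R - t - n.+1%:R) (subX n.+1%:R (phisigY n.+1)) =1
  fun w => (N%:R - t - n.+1%:R) * subY n%:R (phisigY n) w.
Proof.
move=> nN; pose rhoY w := if last ly w then phirho n.+1 w else 0.
(* By [phisig_cons], multiplying by n + 1 - X leaves the series of [phirho], to which [phirho_rec]
   applies. *)
have RE : subX n.+1%:R (phisigY n.+1) =1 rhoY.
  move=> [|l [|l' w]]; rewrite /subX /phisigY /rhoY.
  - by rewrite /= phisig_nil // phirho_nil mulr0 subrr.
  - by case: l => /=; rewrite ?phisig_cons /= ?phisig_nil // !(mulr0, add0r, subr0).
  rewrite [last _ _]/=; case lw: (last l' w); last first.
    by case: l => /=; rewrite ?lw mulr0 subr0.
  rewrite phisig_cons; case: l => /=; first by rewrite add0r subr0.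
  by rewrite lw addrAC subrr add0r.
move=> w; rewrite (subA_ext _ RE); case: w => [|l [|l' w]].
- rewrite /subA /subY /rhoY /phisigY /= phirho_nil.
  have -> : n%:R * phisig n [::] = 0.
    by case: (n) => [|n']; rewrite ?mul0r // phisig_nil ?mulr0.
  by rewrite !(mulr0, subr0, addr0).
- case: l; last first.
    by rewrite /subA /subY /rhoY /phisigY /= phirho_nil !(mulr0, subr0, addr0).
  have := @phirho_rec n true [::] nN isT.
  by rewrite /subA /subY /rhoY /phisigY /= subr0.
rewrite /subA /subY /rhoY /phisigY [last _ _]/=; case lw: (last l' w); last first.
  by case: l => /=; rewrite lw !(mulr0, subr0, addr0).
have := @phirho_rec n l (l' :: w) nN (orbT _).
by case: l => /= E; rewrite lw ?subr0 ?addr0 E ?subr0.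
Qed.

Fixpoint vprod n : K := if n is n'.+1 then vprod n' * v n else 1.

Definition ncoef n : K := newton_coef ninv (N%:R - t) N%:R n * vprod n.

Lemma phi_harm_hom : (0 < N)%N ->
  is_harm_hom (fun s => \sum_(0 <= n < N) ncoef n * phisigY n (rword s)).
Proof.
move=> N0.
(* The factor [vprod n] absorbs the scalar on the right of [phisigY_rec], giving the recursion of
   the Newton series with u = N - t. *)
pose a n w := vprod n * phisigY n w.
pose F s := newton_sum ninv (N%:R - t) N a N%:R (rword s).
apply: (@is_harm_hom_ext _ F).
  by move=> s; apply: eq_bigr => n _; rewrite mulrA.
apply: (@newton_sum_harm_hom _ _ _ ninvK _ _ _ v vK); last by rewrite N0 leqnn.
- move=> n nN w; have a_lin b c (G : word -> K) w' :
      subA b (subX c (fun w => vprod n.+1 * G w)) w' =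
      vprod n.+1 * subA b (subX c G) w'.
    by case: w' => [|[] [|[] w']]; rewrite /subA /subX /=; ring.
  rewrite a_lin phisigY_rec // mulrA /= -[_ * v _ * _]mulrA vK // mulr1.
  by case: w => [|[] w]; rewrite /subY /a /=; ring.
- by move=> w; rewrite /a /phisigY phisig0 mul1r; case: w => [|l w] //=; case: ifP.
Qed.

(** This is prod_(1 <= i < n) (1 + t/i) times prod_(1 <= i <= n) (N - i)/(N - i - t), as [ninv] is 0
    at 0. *)
Fixpoint connector n : K :=
  if n is n'.+1 then connector n' * (1 + t * ninv n') * (N%:R - n%:R) * v n else 1.

(** At x = N one has x - u = t, and t(t + 1)...(t + n)/(n + 1)! is t/(n + 1) times the product of
    the 1 + t/i for 1 <= i <= n. *)
Lemma connectorE n : t * connector n.+1 * ninv n.+1 = ncoef n.+1.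
Proof.
elim: n => [|n IH]; first by rewrite /ncoef /= ninv0; ring.
rewrite /ncoef /= -/(newton_coef ninv (N%:R - t) N%:R n.+1) -/(vprod n.+1).
transitivity (t * connector n.+1 * (n.+1%:R * ninv n.+1 + n.+1%:R * ninv n.+1 * t * ninv n.+1) *
    (N%:R - n.+2%:R) * v n.+2 * ninv n.+2); first by rewrite ninvK /=; ring.
transitivity ((t * connector n.+1 * ninv n.+1) * (n.+1%:R + t * (n.+1%:R * ninv n.+1)) *
  (N%:R - n.+2%:R) * v n.+2 * ninv n.+2); first by ring.
by rewrite IH ninvK /ncoef /=; ring.
Qed.

Definition phi_gen w : K := \sum_(1 <= n < N) t * connector n * ninv n * phisigY n w.

Lemma phi_gen_harm_hom : (0 < N)%N ->
  is_harm_hom (fun s => if s is [::] then 1 else phi_gen (rword s)).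
Proof.
move=> N0; apply: is_harm_hom_ext (phi_harm_hom N0) => s.
have NE : N = N.-1.+1 by rewrite prednK.
have E0 w : ncoef 0 * phisigY 0 w = (w == [::])%:R.
  by rewrite /ncoef !mul1r /phisigY phisig0; case: w => [|l w] //=; case: ifP.
case: s => [|k s].
  rewrite big_ltn // E0 eqxx big_nat big1 ?addr0 // => n /andP[n0 _].
  by rewrite /phisigY /= phisig_nil // mulr0.
rewrite big_ltn // E0 rword_eq0 add0r /phi_gen !big_nat; apply: eq_bigr => -[|n] // _.
by rewrite connectorE.
Qed.

End WordStates.

(** * Transfer matrices *)

Section Rows.
Variable N : nat.

(* One row_step of the transfer matrix: the contribution of an entry [k] at the value [j],
   either followed by a strict inequality, or (if [k] is 1) weighted by 1/(N-j) and
   followed by a weak one. *)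
Definition row_step (k : nat) (f : nat -> rat) (n : nat) : rat :=
  \sum_(0 <= j < n) f j * j%:R^-1 ^+ k +
  (if k == 1%N then \sum_(1 <= j < n.+1) f j * (N - j)%:R^-1 else 0).

Fixpoint zrow (s : seq nat) : nat -> rat :=
  if s is k :: s' then row_step k (zrow s') else fun=> 1.

Lemma row_stepS k f n : row_step k f n.+1 =
  row_step k f n + f n * n%:R^-1 ^+ k + (if k == 1%N then f n.+1 * (N - n.+1)%:R^-1 else 0).
Proof.
rewrite /row_step big_nat_recr //=; case: eqP => _; rewrite ?addr0 //.
by rewrite [in X in _ + X = _]big_nat_recr //= addrACA addrA.
Qed.

Lemma row_step0 k f : row_step k f 0 = 0.
Proof. by rewrite /row_step !big_geq // add0r; case: ifP. Qed.

Lemma sum_row_step (I : Type) (r : seq I) (F : I -> nat -> rat) k n :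
  \sum_(i <- r) row_step k (F i) n = row_step k (fun n => \sum_(i <- r) F i n) n.
Proof.
rewrite /row_step big_split /=; congr (_ + _).
  by rewrite exchange_big; apply: eq_bigr => j _; rewrite mulr_suml.
case: eqP => _; last by rewrite big1.
by rewrite exchange_big; apply: eq_bigr => j _; rewrite mulr_suml.
Qed.

Definition harm_row s m n : rat := \sum_(u <- rharm s (nseq m 1%N)) zrow u n.

Lemma eq_row_step k f g n : f =1 g -> row_step k f n = row_step k g n.
Proof.
move=> fg; rewrite /row_step; under eq_bigr do rewrite fg.
by case: eqP => // _; under [in X in _ + X]eq_bigr do rewrite fg.
Qed.

Lemma harm_row_nil0 n : harm_row [::] 0 n = 1.
Proof. by rewrite /harm_row big_seq1. Qed.

Lemma harm_row_nilS m n : harm_row [::] m.+1 n = row_step 1 (harm_row [::] m) n.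
Proof. by rewrite /harm_row big_seq1; apply: eq_row_step => j; rewrite big_seq1. Qed.

Lemma harm_row_cons0 k s n : harm_row (k :: s) 0 n = row_step k (harm_row s 0) n.
Proof.
by rewrite /harm_row big_seq1; apply: eq_row_step => j; rewrite rharm_nil big_seq1.
Qed.

Lemma harm_row_consS k s m n : harm_row (k :: s) m.+1 n =
  row_step k (harm_row s m.+1) n + row_step 1 (harm_row (k :: s) m) n +
  row_step k.+1 (harm_row s m) n.
Proof.
rewrite /harm_row [nseq _ _]/= sum_rharm_cons addn1 -!sum_row_step.
by [].
Qed.

End Rows.

(** * Generating function in t of the harmonic products with powers of y *)

Section Truncation.
Variables (K : comNzRingType) (iota : {rmorphism rat -> K}) (N M : nat) (t : K).
Variable v : nat -> K.
Hypothesis vK : forall n, (0 < n < N)%N -> v n * (N%:R - t - n%:R) = 1.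
Hypothesis tM : t ^+ M = 0.

Definition tsum (f : nat -> rat) : K := \sum_(0 <= m < M) t ^+ m * iota (f m).

Lemma eq_tsum f g : f =1 g -> tsum f = tsum g.
Proof. by move=> fg; apply: eq_bigr => m _; rewrite fg. Qed.

Lemma tsumD f g : tsum (fun m => f m + g m) = tsum f + tsum g.
Proof. by rewrite -big_split; apply: eq_bigr => m _; rewrite rmorphD mulrDr. Qed.

Lemma tsumM f c : tsum (fun m => f m * c) = tsum f * iota c.
Proof. by rewrite mulr_suml; apply: eq_bigr => m _; rewrite rmorphM mulrA. Qed.

Lemma tsum0 : tsum (fun=> 0) = 0.
Proof. by rewrite /tsum big1 // => m _; rewrite rmorph0 mulr0. Qed.

Lemma tsum_shift f : tsum (fun m => if m is m'.+1 then f m' else 0) = t * tsum f.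
Proof.
rewrite /tsum; case: M tM => [|M' tM']; first by rewrite !big_geq ?mulr0.
rewrite big_nat_recl // rmorph0 mulr0 add0r [in RHS]big_nat_recr //= mulrDr.
rewrite mulrA -exprS tM' mul0r addr0 mulr_sumr.
by apply: eq_bigr => m _; rewrite mulrA -exprS.
Qed.

Notation ninv := (ninv iota).
Notation connector := (connector iota N t v).
Notation wchi := (wchi iota v).

Definition trunc_row s n := tsum (fun m => harm_row N s m n).

Lemma natB_inv n : (0 < n < N)%N -> (N%:R - n%:R) * iota (N - n)%:R^-1 = 1 :> K.
Proof.
move=> nN; rewrite -natrB; last by lia.
rewrite -(rmorph_nat iota) -rmorphM divff ?rmorph1 // pnatr_eq0; lia.
Qed.

(** The rows T_n satisfy T_(n+1) (1 - t/(N - n - 1)) = T_n (1 + t/n), without the term t/n at n =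
    0. *)
Lemma trunc_row_nil n : (0 < M)%N -> (n < N)%N -> trunc_row [::] n = connector n.
Proof.
move=> M0; elim: n => [|n IH] nN.
  rewrite /trunc_row (@eq_tsum _ (fun m => if m is 0 then 1 else 0)); last first.
    by case=> [|m]; rewrite ?harm_row_nil0 // harm_row_nilS row_step0.
  by rewrite /tsum big_ltn // mul1r rmorph1 big_nat big1 ?addr0 // => -[|m] // _;
    rewrite rmorph0 mulr0.
have E : trunc_row [::] n.+1 =
    trunc_row [::] n + t * (trunc_row [::] n * ninv n + trunc_row [::] n.+1 * iota (N - n.+1)%:R^-1).
  rewrite {1 2 3 4}/trunc_row -!tsumM -tsumD -tsum_shift -tsumD; apply: eq_tsum.
  case=> [|m]; first by rewrite !harm_row_nil0 addr0.
  by rewrite !harm_row_nilS row_stepS expr1 addrA.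
have wK := @natB_inv n.+1 nN; have vK' := @vK n.+1 nN.
set w := iota _ in E wK; set F := trunc_row _ n.+1 in E *.
have {}IH := IH (ltnW nN); rewrite IH in E.
rewrite /= -/(connector n).
transitivity (v n.+1 * (N%:R - t - n.+1%:R) * F); first by rewrite vK' mul1r.
have -> : N%:R - t - n.+1%:R = (N%:R - n.+1%:R) - t :> K by ring.
transitivity (v n.+1 * ((N%:R - n.+1%:R) * F - t * F)); first by ring.
rewrite {1}E.
transitivity (v n.+1 * ((N%:R - n.+1%:R) * (connector n * (1 + t * ninv n)) +
  t * F * ((N%:R - n.+1%:R) * w) - t * F)); first by ring.
by rewrite wK; ring.
Qed.

(** The last letter of a term of the product is e_k, y or e_(k+1); the last two use up a letter y,
    hence the factor t. *)
Lemma trunc_row_cons k s n : (0 < M)%N -> (0 < k)%N -> trunc_row (k :: s) n.+1 =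
  trunc_row (k :: s) n + trunc_row s n * ninv n ^+ k +
  (if k == 1%N then trunc_row s n.+1 * iota (N - n.+1)%:R^-1 else 0) +
  t * (trunc_row (k :: s) n * ninv n + trunc_row (k :: s) n.+1 * iota (N - n.+1)%:R^-1 +
       trunc_row s n * ninv n ^+ k.+1).
Proof.
move=> M0 k0; rewrite /trunc_row.
have -> : (if k == 1%N then tsum (fun m => harm_row N s m n.+1) * iota (N - n.+1)%:R^-1 else 0) =
    tsum (fun m => if k == 1%N then harm_row N s m n.+1 * (N - n.+1)%:R^-1 else 0).
  by case: eqP => _; rewrite ?tsum0 // tsumM.
rewrite /ninv -!(rmorphXn iota) -!tsumM -!tsumD -tsum_shift -tsumD; apply: eq_tsum.
case=> [|m]; first by rewrite !harm_row_cons0 row_stepS addr0.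
have kE : (k.+1 == 1%N) = false by case: (k) k0.
rewrite !harm_row_consS !row_stepS kE addr0 eqxx expr1.
by ring.
Qed.

(** In [trunc_row_cons] the powers of t gather into the factors 1 + t/n and 1 - t/(N - n - 1) that
    define [connector]; dividing by the latter turns 1/(N - n - 1) into [v n.+1]. *)
Lemma trunc_rowE s n : (0 < M)%N -> all (leq 1) s -> (0 < n < N)%N ->
  trunc_row s n = connector n * wchi (rword s) n.
Proof.
move=> M0; elim: s n => [|k s IH] n /=.
  by move=> _ /andP[n0 nN]; rewrite trunc_row_nil // wchi_nil // mulr1.
rewrite -/(rword (k :: s)) => /andP[k0 sP] /andP[_].
(* The induction hypothesis excludes the value 0, where both sides vanish because [ninv] is 0 there
   and k > 0. *)
have IH' n' : (n' < N)%N ->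
    trunc_row s n' * ninv n' ^+ k = connector n' * (wchi (rword s) n' * ninv n' ^+ k).
  case: n' => [|n'] nN; last by rewrite IH ?mulrA.
  by rewrite ninv0 expr0n (negPf (lt0n_neq0 k0)) !mulr0.
elim: n => [|n IHn] nN.
  rewrite wchi0 mulr0 /trunc_row (@eq_tsum _ (fun=> 0)) ?tsum0 // => -[|m].
    by rewrite harm_row_cons0 row_step0.
  by rewrite harm_row_consS !row_step0 !addr0.
have {}IHn := IHn (ltnW nN); have {}IH' := IH' _ (ltnW nN).
have E := trunc_row_cons s n M0 k0; rewrite exprSr mulrA IH' IHn in E.
have wK := @natB_inv n.+1 nN; have vK' := @vK n.+1 nN.
have IH1 := IH n.+1 sP nN.
rewrite wchi_rwordS //.
set w := iota _ in E wK; set F := trunc_row _ n.+1 in E *.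
transitivity (v n.+1 * (N%:R - t - n.+1%:R) * F); first by rewrite vK' mul1r.
have -> : N%:R - t - n.+1%:R = (N%:R - n.+1%:R) - t :> K by ring.
transitivity (v n.+1 * ((N%:R - n.+1%:R) * F - t * F)); first by ring.
rewrite {1}E; set X := wchi _ n; set Y := wchi _ n * _.
pose Z := if k == 1%N then trunc_row s n.+1 else 0.
have -> : (if k == 1%N then trunc_row s n.+1 * w else 0) = Z * w.
  by rewrite /Z; case: ifP => _; rewrite ?mul0r.
transitivity (v n.+1 * ((N%:R - n.+1%:R) * (connector n * (1 + t * ninv n) * (X + Y))
   + (t * F + Z) * ((N%:R - n.+1%:R) * w) - t * F)); first by ring.
rewrite wK.
have -> : (if k == 1%N then wchi (rword s) n.+1 * v n.+1 else 0) =
   (if k == 1%N then wchi (rword s) n.+1 else 0) * v n.+1.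
  by case: ifP => _; rewrite ?mul0r.
transitivity (connector n.+1 * (X + Y) + v n.+1 * Z); first by rewrite /=; ring.
rewrite [RHS]mulrDr; congr (_ + _); rewrite /Z; case: ifP => _; rewrite ?mul0r ?mulr0 //.
by rewrite IH1; ring.
Qed.

End Truncation.

(** * Evaluation of the finite sums zeta *)

Section Chains.
Variables (R : comNzRingType) (T : finType) (w : nat -> T -> R) (tr : T -> T -> R).

Definition ffun_rcons n (g : {ffun 'I_n -> T}) (x : T) : {ffun 'I_n.+1 -> T} :=
  [ffun i => if unlift ord_max i is Some j then g j else x].

Lemma ffun_rcons_max n (g : {ffun 'I_n -> T}) x : ffun_rcons g x ord_max = x.
Proof. by rewrite ffunE unlift_none. Qed.

Lemma ffun_rcons_widen n (g : {ffun 'I_n -> T}) x i :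
  ffun_rcons g x (widen_ord (leqnSn n) i) = g i.
Proof.
have -> : widen_ord (leqnSn n) i = lift ord_max i by apply/val_inj/esym/lift_max.
by rewrite ffunE liftK.
Qed.

Lemma sum_ffun_last n (F : {ffun 'I_n.+1 -> T} -> R) x :
  \sum_(f : {ffun 'I_n.+1 -> T} | f ord_max == x) F f = \sum_g F (ffun_rcons g x).
Proof.
rewrite (reindex_onto (fun g => ffun_rcons g x)
  (fun f => [ffun j => f (widen_ord (leqnSn n) j)])) /=.
  apply: eq_bigl => g; rewrite ffun_rcons_max eqxx /=; apply/eqP/ffunP => j.
  by rewrite ffunE ffun_rcons_widen.
move=> f /eqP fx; apply/ffunP => i; rewrite ffunE.
case: unliftP => [j ->|-> //]; rewrite ffunE; congr (f _).
exact/val_inj/esym/lift_max.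
Qed.

Fixpoint chain_row n (x : T) : R :=
  if n is n'.+1 then (\sum_y chain_row n' y * tr y x) * w n x else w 0 x.

Definition chain_weight n (f : {ffun 'I_n.+1 -> T}) : R :=
  \prod_(i < n.+1) w i (f i) *
  \prod_(i < n) tr (f (widen_ord (leqnSn n) i)) (f (lift ord0 i)).

Lemma chain_weight_rcons n (f : {ffun 'I_n.+1 -> T}) x :
  chain_weight (ffun_rcons f x) = chain_weight f * tr (f ord_max) x * w n.+1 x.
Proof.
rewrite /chain_weight big_ord_recr [\prod_(i < n.+1) tr _ _]big_ord_recr /=.
rewrite ffun_rcons_max.
have -> : lift ord0 ord_max = ord_max :> 'I_n.+2 by apply/val_inj.
rewrite ffun_rcons_max ffun_rcons_widen.
under eq_bigr do rewrite ffun_rcons_widen.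
under [X in _ * (X * _)]eq_bigr => i _.
  rewrite ffun_rcons_widen.
  have -> : lift ord0 (widen_ord (leqnSn n) i) = widen_ord (leqnSn n.+1) (lift ord0 i).
    by apply/val_inj.
  rewrite ffun_rcons_widen; over.
by ring.
Qed.

Lemma sum_chain_last n x :
  \sum_(f : {ffun 'I_n.+1 -> T} | f ord_max == x) chain_weight f = chain_row n x.
Proof.
elim: n x => [|n IH] x; rewrite sum_ffun_last.
  under eq_bigr => g _.
    rewrite /chain_weight big_ord1 big_ord0 mulr1 (_ : ord0 = ord_max) ?ffun_rcons_max; [over|exact/val_inj].
  by rewrite sumr_const card_ffun card_ord expn0.
under eq_bigr do rewrite chain_weight_rcons.
rewrite (partition_big (fun g : {ffun _ -> T} => g ord_max) xpredT) //= mulr_suml.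
apply: eq_bigr => y _; rewrite -IH !mulr_suml.
by apply: eq_bigr => g /eqP ->.
Qed.

Lemma sum_chain n :
  \sum_(f : {ffun 'I_n.+1 -> T}) chain_weight f = \sum_x chain_row n x.
Proof.
rewrite (partition_big (fun g : {ffun _ -> T} => g ord_max) xpredT) //=.
by apply: eq_bigr => x _; rewrite sum_chain_last.
Qed.

End Chains.

Lemma prod_bool (R : comNzRingType) (I : finType) (c : pred I) :
  \prod_i ((c i)%:R : R) = [forall i, c i]%:R.
Proof.
case: forallP => [cT | cF]; first by rewrite big1 // => i _; rewrite cT.
have /existsP [i /negPf ci] : [exists i, ~~ c i].
  by rewrite -negb_forall; apply/negP => /forallP.
by rewrite (bigD1 i) //= ci mul0r.
Qed.

Section ZetaRows.
Variables (N r : nat) (k : nat -> nat).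

(** The Boolean records membership of i in A, and the constraints on a single entry become a factor
    0 or 1. *)
Definition zeta_weight (i : nat) (x : bool * 'I_N) : rat :=
  ((0 < x.2)%N && (x.1 ==> (k i == 1%N)))%:R *
  (if x.1 then (N - x.2)%:R^-1 else x.2%:R ^- k i).

Definition zeta_rel (x y : bool * 'I_N) : rat :=
  (if x.1 then x.2 <= y.2 else x.2 < y.2)%N%:R.

Lemma zeta_chain :
  (\sum_(A : {set 'I_r.+1} | [forall i in A, k i == 1%N])
   \sum_(n : {ffun 'I_r.+1 -> 'I_N} |
          [forall i, 0 < n i]%N &&
          [forall i : 'I_r.+1, forall j : 'I_r.+1, (nat_of_ord j == i.+1) ==>
              (if i \in A then (n i <= n j)%N else (n i < n j)%N)])
     (\prod_(i in A) ((N - n i)%:R)^-1 *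
      \prod_(i : 'I_r.+1 | i \notin A) ((n i)%:R ^- k i))) =
  \sum_x chain_row zeta_weight zeta_rel r x.
Proof.
rewrite -sum_chain pair_big_dep /=.
pose h (f : {ffun 'I_r.+1 -> bool * 'I_N}) :=
  ([set i | (f i).1], [ffun i => (f i).2] : {ffun 'I_r.+1 -> 'I_N}).
rewrite (reindex h); last first.
  exists (fun p : {set 'I_r.+1} * {ffun 'I_r.+1 -> 'I_N} => [ffun i => (i \in p.1, p.2 i)]).
    by move=> f _; apply/ffunP => i; rewrite !ffunE inE; case: (f i).
  move=> [A n] _; congr (_, _) => /=; first by apply/setP => i; rewrite inE ffunE.
  by apply/ffunP => i; rewrite !ffunE.
rewrite big_mkcond; apply: eq_bigr => f _ /=.
rewrite /chain_weight /zeta_weight big_split prod_bool /zeta_rel prod_bool /=.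
set c1 := [forall i in _, _]; set c2 := [forall i, _]; set c3 := [forall i, _].
set c4 := [forall i, _]; set c5 := [forall i, _].
have -> : c4 = c2 && c1.
  apply/forallP/andP => [H|[/forallP H2 /forallP H1] i].
    split; apply/forallP => i; have /andP[] := H i; first by rewrite ffunE.
    by rewrite inE.
  by have := H1 i; have := H2 i; rewrite ffunE inE => -> ->.
have -> : c5 = c3.
  apply/forallP/forallP => H i.
    apply/forallP => j; apply/implyP => /eqP ji; have ir : (i < r)%N by have := ltn_ord j; lia.
    have := H (Ordinal ir); rewrite inE !ffunE.
    have -> : widen_ord (leqnSn r) (Ordinal ir) = i by apply/val_inj.
    by have -> : lift ord0 (Ordinal ir) = j by apply/val_inj.
  have /forallP/(_ (lift ord0 i)) := H (widen_ord (leqnSn r) i).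
  by rewrite !ffunE inE /= eqxx.
have -> : \prod_i (if (f i).1 then (N - (f i).2)%:R^-1 else (f i).2%:R ^- k i) =
   \prod_(i in [set i | (f i).1]) (N - [ffun i => (f i).2] i)%:R^-1 *
   \prod_(i | i \notin [set i | (f i).1]) ([ffun i => (f i).2] i)%:R ^- k i :> rat.
  rewrite (bigID (mem [set i | (f i).1])) /=; congr (_ * _).
    by apply: eq_bigr => i; rewrite inE ffunE => ->.
  by apply: eq_bigr => i; rewrite inE ffunE => /negPf ->.
by case: c1 c2 c3 => -[] -[]; rewrite /= ?mul1r ?mulr1 ?mul0r ?mulr0.
Qed.

Fixpoint rev_prefix n : seq nat := if n is n'.+1 then k n' :: rev_prefix n' else [::].

Lemma rev_prefixE n : rev_prefix n = rev (mkseq k n).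
Proof. by elim: n => // n IH; rewrite /= IH mkseqS rev_rcons. Qed.

Lemma sum_bool_ord (F : bool * 'I_N -> rat) :
  \sum_x F x = \sum_(n < N) F (true, n) + \sum_(n < N) F (false, n).
Proof.
transitivity (\sum_b \sum_n F (b, n)); last by rewrite big_bool.
by rewrite pair_bigA; apply: eq_bigr => -[].
Qed.

Lemma chain_rowE n x : (forall i, (i < n)%N -> 0 < k i)%N ->
  chain_row zeta_weight zeta_rel n x = zrow N (rev_prefix n) x.2 * zeta_weight n x.
Proof.
elim: n x => [|n IH] x kP; first by rewrite /= mul1r.
rewrite [LHS]/=; congr (_ * _).
have {}IH y : chain_row zeta_weight zeta_rel n y = zrow N (rev_prefix n) y.2 * zeta_weight n y.
  by apply: IH => i iN; apply: kP; apply: leqW.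
under eq_bigr do rewrite IH.
rewrite sum_bool_ord /= addrC /row_step; congr (_ + _).
  rewrite (big_nat_widen _ _ _ _ _ (ltnW (ltn_ord x.2))) big_mkord [RHS]big_mkcond /=.
  apply: eq_bigr => -[m mN] _; rewrite /zeta_weight /zeta_rel /= andbT.
  case: (ltnP m x.2) => _ /=; last by rewrite mulr0.
  case: m mN => [|m] mN /=; last by rewrite mulr1 mul1r exprVn.
  by rewrite invr0 expr0n (negPf (lt0n_neq0 (kP n _))) // !(mulr0, mul0r).
case: eqVneq => kn; last first.
  by rewrite big1 // => m _; rewrite /zeta_weight /= (negPf kn) andbF !(mul0r, mulr0).
rewrite (big_nat_widenl 1 0) // (big_nat_widen _ _ _ _ _ (ltn_ord x.2)) big_mkord [RHS]big_mkcond /=.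
apply: eq_bigr => -[m mN] _; rewrite /zeta_weight /zeta_rel /= kn eqxx andbT ltnS.
by case: (0 < m)%N; case: (m <= _)%N; rewrite /= !(mulr1, mul1r, mulr0, mul0r).
Qed.

End ZetaRows.

Lemma zeta_dia_rows N k s : (1 < k)%N -> all (leq 1) s ->
  zeta_dia_N N (rev (k :: s)) = \sum_(0 <= n < N) zrow N s n * n%:R^-1 ^+ k.
Proof.
move=> k1 sP; rewrite /zeta_dia_N size_rev /=.
rewrite zeta_chain.
set kk := nth 0%N _.
have E : rev_prefix kk (size s).+1 = k :: s.
  have -> : (size s).+1 = size (rev (k :: s)) by rewrite size_rev.
  by rewrite rev_prefixE mkseq_nth revK.
have [kE sE] : kk (size s) = k /\ rev_prefix kk (size s) = s by case: E.
have kkP i : (i < size s)%N -> (0 < kk i)%N.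
  move=> iN; apply: (all_nthP 0%N (_ : all (leq 1) (rev (k :: s)))); rewrite ?size_rev /= 1?ltnW //.
  by rewrite all_rev /= sP andbT ltnW.
rewrite (eq_bigr _ (fun x _ => chain_rowE x kkP)) sE.
(* The last entry exceeds 1, so its position cannot lie in A. *)
rewrite sum_bool_ord big1 => [|n _]; last first.
  by rewrite /zeta_weight /= kE gtn_eqF // andbF mul0r mulr0.
rewrite add0r big_mkord; apply: eq_bigr => -[n nN] _; rewrite /zeta_weight /= kE andbT.
case: n nN => [|n] _ /=; last by rewrite mul1r exprVn.
by rewrite invr0 expr0n gtn_eqF ?(ltnW k1) // !(mulr0, mul0r).
Qed.

(** * The generating series in t *)

Lemma truncated_ring m : exists (K : comNzRingType) (iota : {rmorphism rat -> K}) (t : K),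
  t ^+ m.+1 = 0 /\ forall f g h : nat -> rat,
    tsum iota m.+1 t f * tsum iota m.+1 t g = tsum iota m.+1 t h ->
    \sum_(0 <= a < m.+1) f a * g (m - a)%N = h m.
Proof.
pose P : {poly rat} := 'X^(m.+1).
have inP p i : (i < m.+1)%N -> (in_qpoly P p)`_i = p`_i.
  move=> im; rewrite /= mk_monic_Xn -Pdiv.RingMonic.take_poly_rmodp coef_take_poly.
  by rewrite im.
(* In Q[t]/(t^(m+1)) the coefficient of t^m is still well defined, and for a product it is the
   convolution. *)
exists {poly %/ P}, (in_qpoly P \o polyC), (in_qpoly P 'X); split.
  apply/val_inj/polyP => i; rewrite -rmorphXn /= mk_monic_Xn coef0.
  by rewrite -Pdiv.RingMonic.take_poly_rmodp coef_take_poly coefXn; case: ltngtP.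
move=> f g h.
have tE F : tsum (in_qpoly P \o polyC) m.+1 (in_qpoly P 'X) F = in_qpoly P (\poly_(i < m.+1) F i).
  rewrite poly_def rmorph_sum /tsum big_mkord; apply: eq_bigr => i _.
  by rewrite -mul_polyC rmorphM mulrC rmorphXn.
rewrite !tE -rmorphM => /(congr1 (fun p : {poly %/ P} => p`_m)).
rewrite !inP // coefM coef_poly ltnSn => <-; rewrite big_mkord; apply: eq_bigr => i _.
by rewrite !coef_poly ltn_ord ltnS leq_subr.
Qed.

Lemma geometric_inverse (K : comNzRingType) (t a q : K) M :
  q * a = 1 -> t ^+ M = 0 -> (q * \sum_(i < M) (t * q) ^+ i) * (a - t) = 1.
Proof.
move=> qa tM; have := subrX1 (t * q) M; rewrite exprMn tM mul0r sub0r.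
set S := \sum_(i < M) _ => E.
transitivity ((q * a) * S - t * q * S); first by ring.
by rewrite qa mul1r -[RHS]opprK E; ring.
Qed.

(** * Words and indices *)

Lemma rev_of_idx s : rev (of_idx s) = rword (rev s).
Proof.
elim/last_ind: s => // s k IH.
rewrite rev_rcons /= -IH /of_idx map_rcons flatten_rcons rev_cat.
by rewrite /e rev_cons rev_nseq cat_rcons.
Qed.

Lemma to_idx_aux_nseq c j w : to_idx_aux c (nseq j lx ++ w) = to_idx_aux (c + j) w.
Proof. by elim: j c => [|j IH] c; rewrite ?addn0 //= IH addSnnS. Qed.

Lemma to_idx_of_idx s : all (leq 1) s -> to_idx (of_idx s) = Some s.
Proof.
case: s => // k s /= /andP[k0 sP]; congr Some.
elim: s k k0 sP => [|k' s IH] k k0 /=; rewrite to_idx_aux_nseq add1n prednK //.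
by move=> /andP[k'0 sP] /=; rewrite IH.
Qed.

Lemma of_idx_aux c w : (0 < c)%N ->
  of_idx (to_idx_aux c w) = ly :: nseq c.-1 lx ++ w /\ all (leq 1) (to_idx_aux c w).
Proof.
elim: w c => [|[] w IH] c c0 /=.
- by rewrite c0 /of_idx /= /e.
- by have [] := IH 1%N isT; rewrite /of_idx /= => -> ->; rewrite c0.
have [] := IH c.+1 isT; rewrite /of_idx => -> ->; split=> //.
case: c c0 => // c _ /=; congr (_ :: _).
by elim: c => //= c ->.
Qed.

Lemma yword_idx w : head lx w = ly ->
  exists s, [/\ w = of_idx s, s != [::] & all (leq 1) s].
Proof.
case: w => // -[] // w _; exists (to_idx_aux 1 w).
have [<- ->] := @of_idx_aux 1 w isT; split=> //.
by move: 1%N; elim: w => [|[] w IH] c //=.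
Qed.

Lemma phi_word_head w b : head lx w = ly -> b \in phi_word w -> head lx b.2 = ly.
Proof.
by case: w => // -[] // w _ /=; rewrite /pmul /= cats0 => /mapP[a _ ->].
Qed.

Lemma rharm_pos s t : all (leq 1) s -> all (leq 1) t ->
  all (fun u => all (leq 1) u && ((s != [::]) ==> (u != [::]))) (rharm s t).
Proof.
have [n] := ubnP (size s + size t)%N.
elim: n s t => // n IH s t; case: s => [|k1 u1]; first by move=> _ _ pt; rewrite /= pt.
case: t => [|k2 u2] sn ps pt; first by rewrite rharm_nil all_seq1 ps.
have /andP[k10 pu1] := ps; have /andP[k20 pu2] := pt; rewrite /= in sn.
rewrite rharm_cons !all_cat !all_map; apply/and3P; split; apply/allP => u uin /=.
- by have /allP/(_ _ uin)/andP[-> _] := IH u1 (k2 :: u2) ltac:(rewrite /=; lia) pu1 pt; rewrite k10.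
- by have /allP/(_ _ uin)/andP[-> _] := IH (k1 :: u1) u2 ltac:(rewrite /=; lia) ps pu2; rewrite k20.
- have /allP/(_ _ uin)/andP[-> _] := IH u1 u2 ltac:(lia) pu1 pu2; lia.
Qed.

(** * Multiplicativity of the generating series of the values Z *)

Section Assembly.
Variable N : nat.

Definition zword (w : word) (j : nat) : rat := Zdia (cst [:: (1, w)] (ypow j)) N.
Definition zphi (w : word) (j : nat) : rat := \sum_(b <- phi_word w) b.1 * zword b.2 j.

Lemma Zdia_flatten (I : Type) (r : seq I) (F : I -> Hpoly) :
  Zdia (flatten [seq F i | i <- r]) N = \sum_(i <- r) Zdia (F i) N.
Proof. by rewrite /Zdia big_flatten big_map. Qed.

Lemma Zdia_cst p j : Zdia (cst p (ypow j)) N = \sum_(a <- p) a.1 * zword a.2 j.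
Proof.
rewrite Zdia_flatten; apply: eq_bigr => a _.
rewrite /zword /cst /ypow /= !cats0; case: (to_idx a.2) => [s|]; last first.
  by rewrite /Zdia !big_nil mulr0.
case: (to_idx _) => [u|]; last by rewrite /Zdia !big_nil mulr0.
rewrite /Zdia !big_map mulr_sumr; apply: eq_bigr => l _ /=.
by rewrite !mulr1 mul1r.
Qed.

Lemma Zdia_cst_phi p j :
  Zdia (cst (phi p) (ypow j)) N = \sum_(a <- p) a.1 * zphi a.2 j.
Proof.
rewrite Zdia_cst /phi big_flatten big_map; apply: eq_bigr => a _.
rewrite big_map /zphi mulr_sumr; apply: eq_bigr => b _ /=.
by rewrite mulrA.
Qed.

(** One of the j + 1 letters y merges with e_k into e_(k+1); the other j enter through the harmonic
    product. *)
Lemma zwordE k s j : all (leq 1) (k :: s) ->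
  zword (of_idx (rev (k :: s))) j.+1 =
  \sum_(0 <= n < N) harm_row N s j n * n%:R^-1 ^+ k.+1.
Proof.
move=> /[dup] ksP /andP[k0 sP].
have E1 : to_idx (of_idx (rev (k :: s))) = Some (rev (k :: s)).
  by rewrite to_idx_of_idx // all_rev.
have E2 : to_idx (nseq j.+1 ly) = Some (nseq j.+1 1%N).
  by rewrite /=; congr Some; elim: j => //= j [->].
have cst1 w w' u u' : to_idx w = Some u -> to_idx w' = Some u' ->
    cst [:: (1, w)] [:: (1, w')] = [seq (1 * 1, of_idx l) | l <- cst_idx u u'].
  by move=> Eu Eu'; rewrite /cst /= Eu Eu' !cats0.
rewrite /zword /ypow (cst1 _ _ _ _ E1 E2) /Zdia big_map /cst_idx revK rev_nseq.
rewrite -[nseq j.+1 1%N]/(1%N :: nseq j 1%N) big_map addn1.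
under [RHS]eq_bigr do rewrite mulr_suml; rewrite exchange_big /=.
have js : all (leq 1) (nseq j 1%N) by rewrite all_nseq orbT.
apply: eq_big_seq => l lin; rewrite mulr1 mul1r /Zdia_word.
have /allP/(_ _ lin)/andP[lP _] := rharm_pos sP js.
by rewrite to_idx_of_idx ?all_rev // zeta_dia_rows.
Qed.

Variables (K : comNzRingType) (iota : {rmorphism rat -> K}) (M : nat) (t : K).
Variable v : nat -> K.
Hypothesis vK : forall n, (0 < n < N)%N -> v n * (N%:R - t - n%:R) = 1.
Hypothesis tM : t ^+ M = 0.
Hypothesis M0 : (0 < M)%N.

Lemma zphi0 w : head lx w = ly -> zphi w 0 = 0.
Proof.
move=> hw; rewrite /zphi big_seq big1 // => b /(phi_word_head hw)/yword_idx[s [-> _ sP]].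
rewrite /zword /cst /= to_idx_of_idx //= /cst_idx /=; case: (rev s) => [|? ?];
by rewrite /Zdia /= big_nil mulr0.
Qed.

(** By [trunc_rowE], [connector] times [wsigma] sums the inserted letters y; the extra factor t/n
    accounts for the letter that merges with the last e_k. *)
Lemma phi_gen_zphi w : head lx w = ly ->
  phi_gen iota N t v (rev w) = tsum iota M t (zphi w).
Proof.
move=> hw; rewrite /phi_gen /phisigY.
have -> : last ly (rev w) = ly by case: w hw => //= l w; rewrite rev_cons last_rcons.
under eq_bigr do rewrite /phisig /phi_rlift revK /phi_lift mulr_sumr.
rewrite exchange_big /tsum.
under [RHS]eq_bigr do rewrite /zphi rmorph_sum mulr_sumr.
rewrite [RHS]exchange_big /=; apply: eq_big_seq => b /(phi_word_head hw)/yword_idx[s [-> s0 sP]].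
have [k [s' sE]] : exists k s', s = rev (k :: s').
  by case/lastP: s s0 {sP} => // s' k _; exists k, (rev s'); rewrite rev_cons revK.
rewrite sE in sP *; rewrite all_rev in sP; have /andP[k0 s'P] := sP.
rewrite rev_of_idx revK.
transitivity (iota b.1 * (t * tsum iota M t
    (fun m => \sum_(0 <= n < N) harm_row N s' m n * n%:R^-1 ^+ k.+1))).
  have -> : tsum iota M t (fun m => \sum_(0 <= n < N) harm_row N s' m n * n%:R^-1 ^+ k.+1) =
      \sum_(0 <= n < N) trunc_row iota N M t s' n * ninv iota n ^+ k.+1.
    rewrite /tsum; under eq_bigr do rewrite rmorph_sum mulr_sumr.
    rewrite exchange_big; apply: eq_bigr => n _.
    by rewrite /trunc_row mulr_suml; apply: eq_bigr => m _; rewrite rmorphM rmorphXn mulrA.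
  rewrite !mulr_sumr; case: (posnP N) => [->|N0]; first by rewrite !big_geq.
  rewrite [RHS]big_ltn // ninv0 expr0n !mulr0 add0r !big_nat; apply: eq_bigr => n nN.
  by rewrite wsigma_rword // (trunc_rowE iota vK tM) // exprSr; ring.
(* The factor t shifts the exponent by one, and the coefficient at exponent 0 vanishes. *)
rewrite -tsum_shift // /tsum mulr_sumr; apply: eq_bigr => m _.
rewrite rmorphM mulrCA; congr (_ * (_ * iota _)); case: m => [|m]; last by rewrite zwordE.
rewrite /zword /cst /= to_idx_of_idx ?all_rev //= /cst_idx revK /=.
by rewrite /Zdia big_nil.
Qed.

Lemma zphi_mul s u : (0 < N)%N -> s != [::] -> u != [::] ->
  all (leq 1) s -> all (leq 1) u ->
  tsum iota M t (zphi (of_idx s)) * tsum iota M t (zphi (of_idx u)) =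
  tsum iota M t (fun j => \sum_(l <- harm_idx s u) zphi (of_idx l) j).
Proof.
have head_of l : l != [::] -> head lx (of_idx l) = ly by case: l.
move=> N0 s0 u0 sP uP; rewrite -!phi_gen_zphi ?head_of // !rev_of_idx.
have [_ /(_ (rev s) (rev u))] := phi_gen_harm_hom iota vK N0.
rewrite !all_rev => /(_ sP uP).
have rev0 (l : seq nat) : l != [::] -> rev l != [::] by rewrite -!size_eq0 size_rev.
have F_cons l : l != [::] ->
  (if l is [::] then 1 else phi_gen iota N t v (rword l)) = phi_gen iota N t v (rword l) by case: l.
rewrite !F_cons ?rev0 // => <-.
transitivity (\sum_(l <- harm_idx s u) tsum iota M t (zphi (of_idx l))); last first.
  rewrite /tsum exchange_big; apply: eq_bigr => j _.
  by rewrite rmorph_sum mulr_sumr.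
rewrite /harm_idx big_map; apply: eq_big_seq => l lin.
have rsP : all (leq 1) (rev s) by rewrite all_rev.
have ruP : all (leq 1) (rev u) by rewrite all_rev.
have /allP/(_ _ lin)/andP[lP /implyP/(_ (rev0 _ s0)) l0] := rharm_pos rsP ruP.
by rewrite F_cons // -phi_gen_zphi ?head_of ?rev0 // rev_of_idx revK.
Qed.

End Assembly.

Lemma zphi_conv N m s u : (0 < N)%N -> s != [::] -> u != [::] ->
  all (leq 1) s -> all (leq 1) u ->
  \sum_(1 <= a < m) zphi N (of_idx s) a * zphi N (of_idx u) (m - a) =
  \sum_(l <- harm_idx s u) zphi N (of_idx l) m.
Proof.
move=> N0 s0 u0 sP uP; have [K [iota [t [tM coefE]]]] := truncated_ring m.
pose q n : K := iota (N - n)%:R^-1.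
pose v n := q n * \sum_(i < m.+1) (t * q n) ^+ i.
have vK n : (0 < n < N)%N -> v n * (N%:R - t - n%:R) = 1.
  move=> nN; rewrite addrAC; apply: geometric_inverse => //.
  by rewrite mulrC (natB_inv iota nN).
have head_of l : l != [::] -> head lx (of_idx l) = ly by case: l.
rewrite -(coefE _ _ _ (zphi_mul iota vK tM isT N0 s0 u0 sP uP)).
(* The convolution runs from 0 to m; both ends contain the value at exponent 0, which is 0. *)
rewrite [RHS]big_nat_recr //= subnn [X in _ + _ * X]zphi0 ?head_of // mulr0 addr0.
case: m {tM coefE v vK} => [|m]; first by rewrite !big_geq.
by rewrite [RHS]big_ltn // zphi0 ?head_of // mul0r add0r.
Qed.

Theorem mainTheorem8 (m : nat) (w1 w2 : Hpoly) :
  (0 < m)%N -> in_yH w1 -> in_yH w2 ->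
  forall N : nat, (0 < N)%N ->
    \sum_(1 <= a < m) Zdia (cst (phi w1) (ypow a)) N
                      * Zdia (cst (phi w2) (ypow (m - a))) N
    = Zdia (cst (phi (harm w1 w2)) (ypow m)) N.
Proof.
move=> _ /allP w1P /allP w2P N N0; rewrite Zdia_cst_phi /harm big_flatten big_map.
under [LHS]eq_bigr do rewrite !Zdia_cst_phi mulr_suml.
(* By bilinearity it suffices to treat single words, which are given by nonempty indices. *)
rewrite exchange_big; apply: eq_big_seq => a /w1P /eqP/yword_idx[s [aE s0 sP]].
rewrite big_flatten big_map.
under eq_bigr do rewrite mulr_sumr.
rewrite exchange_big; apply: eq_big_seq => b /w2P /eqP/yword_idx[u [bE u0 uP]].
rewrite aE bE !to_idx_of_idx // big_map -mulr_sumr -zphi_conv // mulr_sumr.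
by apply: eq_bigr => i _; rewrite mulrACA.
Qed.
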